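(* Let $G$ be a topological group and let $(X,p,B,G)$ be a quasi-principal fiber $G$-bundle whose base space $B$ is Hausdorff. Then the action of $G$ on $X$ is principal, i.e., free and proper.
   Context: A bundle $(X,p,B)$ consists of topological spaces $X,B$ and a continuous surjective map $p\colon X\to B$. A fiber bundle with fiber a topological space $F$ is a bundle $p\colon X\to B$ such that each point of $B$ has a neighborhood $U$ and a homeomorphism $\psi\colon U\times F\to p^{-1}(U)$ with $p\circ\psi$ equal to the projection on the first factor; a family of such pairs $\{(U_i,\psi_i)\}$ with the $U_i$ covering $B$ is a coordinate representation. A quasi-principal fiber $G$-bundle $(X,p,B,G)$ is a fiber bundle with fiber $G$ for which there is a continuous right action of $G$ on $X$ and a coordinate representation $\{(U_i,\psi_i)\}$ such that $\psi_i(b,gh)=\psi_i(b,g)\cdot h$ for all $b\in U_i$, $g,h\in G$. An action is free if $x\cdot g=x$ for some $x$ implies $g=e$. A map $f\colon Y\to Z$ is proper if it is continuous and $f\times 1_T\colon Y\times T\to Z\times T$ is closed for every topological space $T$. A continuous action of $G$ on $X$ is proper if the map $X\times G\to X\times X$, $(x,g)\mapsto(x,x\cdot g)$, is proper. *)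

(* Defs.v *)
From HB Require Import structures.
From mathcomp Require Import all_boot.
From mathcomp Require Import all_classical topology.

Set Implicit Arguments.
Unset Strict Implicit.
Unset Printing Implicit Defensive.

Local Open Scope classical_set_scope.
Local Open Scope group_scope.

HB.mixin Record Topological_Group_isTopologicalGroup G
    & Topological G & Group G := {
  mulg_continuous : continuous (fun gh : G * G => gh.1 * gh.2) ;
  invg_continuous : continuous (fun g : G => g^-1)
}.

#[short(type="topologicalGroupType")]
HB.structure Definition TopologicalGroup :=
  {G of Topological_Group_isTopologicalGroup G & Topological G & Group G}.

Definition homeomorphism (Y Z : topologicalType) (f : Y -> Z) : Prop :=
  continuous f /\
  exists g : Z -> Y, [/\ continuous g, cancel f g & cancel g f].

Definition bundle (X B : topologicalType) (p : X -> B) : Prop :=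
  continuous p /\ range p = setT.

(* A set used as a type is its `set_type`, with the subspace topology. *)
Definition local_trivialization (F X B : topologicalType) (p : X -> B)
    (U : set B) (psi : U * F -> p @^-1` U) : Prop :=
  homeomorphism psi /\
  forall (b : U) (f : F), p (set_val (psi (b, f))) = set_val b.

Definition fiber_bundle (F X B : topologicalType) (p : X -> B) : Prop :=
  bundle p /\
  forall b : B, exists (U : set B) (psi : U * F -> p @^-1` U),
    nbhs b U /\ local_trivialization psi.

(* As in the local triviality condition of `fiber_bundle`, the sets `U i` are
   neighborhoods, not necessarily open, and covering `B` means that every point
   has some `U i` among its neighborhoods; covers by open sets are the special
   case in which this reads `\bigcup_i U i = setT`. *)
Definition coordinate_representation (F X B : topologicalType) (p : X -> B)
    (I : Type) (U : I -> set B)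
    (psi : forall i, U i * F -> p @^-1` (U i)) : Prop :=
  (forall b : B, exists i, nbhs b (U i)) /\
  forall i, local_trivialization (psi i).

Definition continuous_right_action (X : topologicalType)
    (G : topologicalGroupType) (act : X -> G -> X) : Prop :=
  [/\ forall x, act x 1 = x,
      forall x g h, act x (g * h) = act (act x g) h &
      continuous (fun xg : X * G => act xg.1 xg.2)].

Definition quasi_principal_bundle (G : topologicalGroupType)
    (X B : topologicalType) (p : X -> B) (act : X -> G -> X) : Prop :=
  [/\ fiber_bundle G p,
      continuous_right_action act &
      exists (I : Type) (U : I -> set B)
             (psi : forall i, U i * G -> p @^-1` (U i)),
        coordinate_representation psi /\
        forall i (b : U i) (g h : G),
          set_val (psi i (b, g * h)) = act (set_val (psi i (b, g))) h].

Definition free_action (X : Type) (G : groupType) (act : X -> G -> X) : Prop :=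
  forall (x : X) (g : G), act x g = x -> g = 1.

Definition closed_map (Y Z : topologicalType) (f : Y -> Z) : Prop :=
  forall C : set Y, closed C -> closed (f @` C).

Definition proper_map (Y Z : topologicalType) (f : Y -> Z) : Prop :=
  continuous f /\
  forall T : topologicalType,
    closed_map (fun yt : Y * T => (f yt.1, yt.2) : Z * T).

Definition proper_action (X : topologicalType) (G : topologicalGroupType)
    (act : X -> G -> X) : Prop :=
  proper_map (fun xg : X * G => (xg.1, act xg.1 xg.2) : X * X).

Definition principal_action (X : topologicalType) (G : topologicalGroupType)
    (act : X -> G -> X) : Prop :=
  free_action act /\ proper_action act.

(* Main.v *)
(** A trivialization over [U] gives a [G]-equivariant coordinate
    [gamma : X -> G], continuous over the interior of [U].  On pairs of points
    in the same fiber over [U] the group element carrying [x] to [y] is then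
    [gamma x^-1 * gamma y].  Since this formula makes sense and is continuous
    near every point [(x, y)] with [p x = p y], not only on pairs in the same
    fiber, it provides a continuous local left inverse of
    [(x, g) |-> (x, x g)]; this forces closedness near such points.  Points
    [(x, y)] with [p x <> p y] are not in the closure of the image, because [B]
    is Hausdorff. *)
Require Import Defs.
From mathcomp Require Import all_boot.
From mathcomp Require Import all_classical topology.

Local Open Scope classical_set_scope.
Local Open Scope group_scope.

(** Extend by the constant [y0] outside [A]. A subspace neighborhood contains the trace on [A] of an
    ambient open set, and this trace is an ambient neighborhood of [x] as soon as [A] is one. *)
Lemma continuous_set_type_extension (X Y : topologicalType) (A : set X)
    (f : A -> Y) (y0 : Y) : continuous f ->
  exists g : X -> Y, (forall a : A, g (set_val a) = f a) /\
    forall x, nbhs x A -> {for x, continuous g}.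
Proof.
move=> fC.
pose g x := if pselect (x \in A) is left Ax then f (exist _ x Ax) else y0.
have gE (a : A) : g (set_val a) = f a.
  case: a => x Ax; rewrite /g set_valE /=.
  by case: pselect => // Ax'; congr (f (exist _ x _)); exact: Prop_irrelevance.
exists g; split=> // x nA M nM.
have Ax : x \in A by rewrite inE; exact: nbhs_singleton nA.
pose a : A := exist _ x Ax.
have := nM; rewrite -[x]/(set_val a) gE => /fC [_ [[V oV <-] /= Vx VM]].
have nV : nbhs x V by exact: open_nbhs_nbhs.
apply: filterS (filterI nV nA) => z [Vz /mem_set Az].
rewrite /preimage /= -[z]/(set_val (exist _ z Az : A)) gE.
exact: VM.
Qed.

(** [gamma] is the group component of the inverse of [psi], given the value [1] outside the preimage
    of [U]. *)
Lemma equivariant_coordinate (G : topologicalGroupType)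
    (X B : topologicalType) (p : X -> B) (act : X -> G -> X) (U : set B)
    (psi : U * G -> p @^-1` U) :
  continuous p -> local_trivialization psi ->
  (forall (b : U) (g h : G),
    set_val (psi (b, g * h)) = act (set_val (psi (b, g))) h) ->
  exists gamma : X -> G,
    [/\ forall x g, U (p x) ->
          p (act x g) = p x /\ gamma (act x g) = gamma x * g,
        forall x y, U (p x) -> p y = p x ->
          act x ((gamma x)^-1 * gamma y) = y &
        forall x, nbhs (p x) U -> {for x, continuous gamma}].
Proof.
move=> pC [[psiC [phi [phiC psiK phiK]]] ppsi] psiM.
have [|gamma [gammaE gammaC]] :=
  @continuous_set_type_extension _ _ _ (snd \o phi) (1 : G).
  by move=> z; apply: continuous_comp; [exact: phiC | exact: cvg_snd].
have gamma_psi b g : gamma (set_val (psi (b, g))) = g.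
  by rewrite gammaE /= psiK.
have psi_surj x : U (p x) ->
    exists b : U, set_val b = p x /\ x = set_val (psi (b, gamma x)).
  move=> Ux; pose z : p @^-1` U := exist _ x (mem_set Ux).
  have [b [g zE]] : exists b g, z = psi (b, g).
    by exists (phi z).1, (phi z).2; rewrite -surjective_pairing phiK.
  have xE : x = set_val (psi (b, g)) by rewrite -zE.
  by exists b; rewrite xE gamma_psi ppsi.
exists gamma; split.
- move=> x g /psi_surj [b [bE xE]].
  by rewrite {1 3}xE -psiM ppsi gamma_psi.
- move=> x y Ux yx.
  have [b [bE xE]] := psi_surj x Ux.
  have [|c [cE yE]] := psi_surj y; first by rewrite yx.
  (* Now [x] and [y] differ only in their group coordinate. *)
  have bc : b = c by apply: val_inj; rewrite -set_valE bE cE.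
  by rewrite {1}xE -psiM mulVKg bc -yE.
- by move=> x Ux; apply: gammaC; exact: pC.
Qed.

(** If [(z, t)] is in the closure of the image of a closed [C], then [(s z, t)] is in [C]: near
    [(z, t)], applying [s] to the first component sends image points [(f y, u)] back to [(y, u)]. *)
Lemma proper_map_local_left_inverse (Y Z : topologicalType) (f : Y -> Z) :
  continuous f ->
  (forall z, closure (range f) z -> exists s : Z -> Y,
    [/\ f (s z) = z, {for z, continuous s} &
        \forall z' \near z, forall y, f y = z' -> s z' = y]) ->
  proper_map f.
Proof.
move=> fC fs; split=> // T C cC [z t] clzt.
have [|s [fsz sC sK]] := fs z.
  move=> V nV; have [|w [[[y u] _ <-] Vy]] := clzt (fst @^-1` V).
    exact: (@cvg_fst _ _ (nbhs z) (nbhs t)).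
  by exists (f y); split.
exists (s z, t); last by rewrite /= fsz.
apply: cC => W nW.
have sTC : (fun w : Z * T => (s w.1, w.2)) @ (z, t) --> (s z, t).
  apply: cvg_pair; last exact: cvg_snd.
  by apply: (@cvg_comp _ _ _ fst s) sC; exact: cvg_fst.
have nK : nbhs (z, t) [set w : Z * T | forall y, f y = w.1 -> s w.1 = y].
  exact: (@cvg_fst _ _ (nbhs z) (nbhs t) _ _ sK).
have nsW : nbhs (z, t) [set w : Z * T | W (s w.1, w.2)] := sTC _ nW.
have [w [[[y u] Cyu <-] [/= Wy /(_ y erefl) sy]]] := clzt _ (filterI nsW nK).
by exists (y, u); split=> //; rewrite -sy.
Qed.

Theorem proposition3p3 (G : topologicalGroupType) (X B : topologicalType)
    (p : X -> B) (act : X -> G -> X)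
    (hp : quasi_principal_bundle p act) (hB : hausdorff_space B) :
  principal_action act.
Proof.
case: hp => -[[pC _] _] [_ _ actC] [I [U [psi [[Ucov psiT] psiM]]]].
have coord (b : B) : exists V (gamma : X -> G),
    [/\ nbhs b V, forall x g, V (p x) ->
          p (act x g) = p x /\ gamma (act x g) = gamma x * g,
        forall x y, V (p x) -> p y = p x ->
          act x ((gamma x)^-1 * gamma y) = y &
        forall x, nbhs (p x) V -> {for x, continuous gamma}].
  have [i nU] := Ucov b; exists (U i).
  have [gamma [g1 g2 g3]] := equivariant_coordinate _ _ _ _ _ _ _ pC (psiT i) (psiM i).
  by exists gamma.
have p_act x g : p (act x g) = p x.
  by have [V [gamma [/nbhs_singleton Vx /(_ x g Vx)[]]]] := coord (p x).
split=> [x g xg|].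
  (* A fixed point gives [gamma x * g = gamma x], and [gamma x] cancels. *)
  have [V [gamma [/nbhs_singleton Vx /(_ x g Vx)[_]]]] := coord (p x).
  by rewrite xg -{1}[gamma x]mulg1 => /mulgI.
apply: proper_map_local_left_inverse => [z|[x y] clxy].
  by apply: cvg_pair; [exact: cvg_fst | exact: actC].
have pyx : p y = p x.
  (* Image points near [(x, y)] have both components over one base point, which then lies in [V] and
     in [W]. *)
  apply/esym/hB => V W nV nW.
  have nVW : nbhs (x, y) ((p @^-1` V) `*` (p @^-1` W)).
    by exists (p @^-1` V, p @^-1` W) => //; split; exact: pC.
  have [_ [[[x' g] _ <-] [/= Vx' Wx']]] := clxy _ nVW.
  by exists (p x'); split; rewrite // -(p_act x' g).
have [V [gamma [nV gammaM gammaK gammaC]]] := coord (p x).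
exists (fun w => (w.1, (gamma w.1)^-1 * gamma w.2)); split.
- by rewrite /= gammaK //; exact: nbhs_singleton nV.
- apply: cvg_pair; first exact: cvg_fst.
  have g1 : gamma w.1 @[w --> (x, y)] --> gamma x.
    by apply: (@cvg_comp _ _ _ fst gamma) (gammaC x nV); exact: cvg_fst.
  (* The same [gamma] is continuous at [y], because [y] lies over [p x]. *)
  have g2 : gamma w.2 @[w --> (x, y)] --> gamma y.
    apply: (@cvg_comp _ _ _ snd gamma) (gammaC y _); first exact: cvg_snd.
    by rewrite pyx.
  have g1V : (gamma w.1)^-1 @[w --> (x, y)] --> (gamma x)^-1.
    exact: cvg_comp g1 (invg_continuous _).
  exact: cvg_comp (cvg_pair g1V g2) (mulg_continuous (_, _)).
(* It suffices to keep the first component over [V]: in the image the second is in its orbit. *)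
- have nVx : nbhs (x, y) [set w : X * X | V (p w.1)].
    exact: (@cvg_fst _ _ (nbhs x) (nbhs y) _ _ (pC _ _ nV)).
  apply: filterS nVx => -[x1 y1] /= Vx1 [x2 g] /= [x21 <-]; subst x2.
  by have [_ ->] := gammaM x1 g Vx1; rewrite mulKg.
Qed.
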